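(* Let $C$ be a binary cycle code defined by a parity-check matrix $H$ with normal graph $N = N(H)$, let $n$ be the number of edges of $N$ (equivalently, the number of columns of $H$), and let $\zeta_N(u_1,\dots,u_n) \in \mathbb{Z}[[u_1,\dots,u_n]]$ be the edge zeta function of $N$. Then for every $(p_1,\dots,p_n) \in \mathbb{Z}_{\ge 0}^n$, the monomial $u_1^{p_1}\cdots u_n^{p_n}$ has nonzero coefficient in $\zeta_N$ if and only if the exponent vector $(p_1,\dots,p_n)$ is an unscaled pseudo-codeword for $C$ (with respect to $H$).
   Context: **Codes and graphs.** Let $H=(h_{ji})$ be a binary matrix with row index set $J$ and column index set $I=\{1,\dots,n\}$, $n\ge 1$. For $i\in I$ let $J_i=\{j\in J: h_{ji}=1\}$, and for $j\in J$ let $I_j=\{i\in I: h_{ji}=1\}$. The code defined by $H$ is $C=\{x\in\mathbb{F}_2^n : \sum_{i\in I_j}x_i=0 \text{ in } \mathbb{F}_2 \text{ for all } j\in J\}$. It is called a *cycle code* if $|J_i|=2$ for all $i\in I$. In that case the *normal graph* $N(H)$ is the undirected graph with vertex set $J$ and edges $e_1,\dots,e_n$, where $e_i$ joins the two elements of $J_i$. All graphs are assumed to have no self-loops and no multiple edges (so the columns of $H$ are pairwise distinct). **Covers and pseudo-codewords.** The Tanner graph $T(H)$ is the bipartite graph with bit nodes $I$, check nodes $J$, and an edge between $i$ and $j$ iff $h_{ji}=1$. For a positive integer $M$ write $[M]=\{1,\dots,M\}$. An $M$-fold cover $\widetilde T$ of $T(H)$ is specified by a choice of permutations $\pi_{j,i}$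 of $[M]$, one for each $j\in J$ and $i\in I_j$: it has bit nodes $I\times[M]$ and check nodes $J\times[M]$, and check node $(j,m)$ is joined to bit node $(i,\pi_{j,i}(m))$ for each $i\in I_j$. The code $\widetilde C\subseteq\mathbb{F}_2^{I\times[M]}$ described by $\widetilde T$ is the set of all $\widetilde c=(\widetilde c_{i,m})$ with $\sum_{i\in I_j}\widetilde c_{i,\pi_{j,i}(m)}=0$ in $\mathbb{F}_2$ for all $j\in J$, $m\in[M]$. The *unscaled pseudo-codeword* associated with $\widetilde c\in\widetilde C$ is the integer vector whose $i$-th entry is $\sum_{m\in[M]}\widetilde c_{i,m}$, where $\widetilde c_{i,m}\in\{0,1\}$ and the sum is taken in $\mathbb{R}$. A vector is an unscaled pseudo-codeword for $C$ if it arises in this way from some $M\ge1$, some $M$-fold cover $\widetilde T$ of $T(H)$ and some $\widetilde c\in\widetilde C$. **Edge zeta function.** Let $X$ be a graph with edges $e_1,\dots,e_n$. A *cycle* on $X$ is a sequence $\Gamma=(e_{i_1},\dots,e_{i_k})$ of edges (repetitions allowed) that can be directed so that $e_{i_s}$ terminates where $e_{i_{s+1}}$ begins for $1\le s\le k-1$ and $e_{i_k}$ terminates where $e_{i_1}$ begins. It is *backtrackless* if $e_{i_s}\neq e_{i_{s+1}}$ for all $1\le s\le k-1$, *tailless* if $e_{i_1}\ne e_{i_k}$, and *primitive* if there is no cycle $\Theta$ and $r\ge2$ such that $\Gamma=\Theta^r$ (i.e. $\Gamma$ is $\Theta$ followed $r$ times). Two cycles of length $k$ are *equivalent* if one edge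 sequence is a cyclic shift of the other. The monomial of $\Gamma$ is $g(\Gamma)=u_{i_1}\cdots u_{i_k}$. The *edge zeta function* of $X$ is the formal power series $$\zeta_X(u_1,\dots,u_n)=\prod_{[\Gamma]\in A(X)}\bigl(1-g(\Gamma)\bigr)^{-1},$$ where $A(X)$ is the set of equivalence classes of backtrackless, tailless, primitive cycles on $X$. *)

(* Defs.v *)
From HB Require Import structures.
From mathcomp Require Import all_boot all_order all_algebra perm.
From mathcomp Require Import generic_quotient mpoly.
From mathcomp Require Import boolp.

Set Implicit Arguments.
Unset Strict Implicit.
Unset Printing Implicit Defensive.

Import GRing.Theory.
Local Open Scope ring_scope.
Local Open Scope quotient_scope.

(******************************************************************************)
(* R[[u_0, ..., u_(n-1)]]; 'X_{1..n} is the type of exponent vectors.         *)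
(******************************************************************************)

Record mfps (R : Type) (n : nat) := MFPS { fps_coef : 'X_{1..n} -> R }.

Section Ring.
Variables (R : comNzRingType) (n : nat).
Implicit Types (f g h : mfps R n) (m : 'X_{1..n}) (d : nat).

HB.instance Definition _ := gen_eqMixin (mfps R n).
HB.instance Definition _ := gen_choiceMixin (mfps R n).

Lemma mfpsP f g : (forall m, fps_coef f m = fps_coef g m) -> f = g.
Proof. by case: f g => [f] [g] /= fg; congr MFPS; apply/funext. Qed.

Definition fps_const (c : R) : mfps R n := MFPS (fun m => c *+ (m == 0%MM)).
Definition fps_opp f : mfps R n := MFPS (fun m => - fps_coef f m).
Definition fps_add f g : mfps R n := MFPS (fun m => fps_coef f m + fps_coef g m).
Definition fps_mul f g : mfps R n := MFPS (fun m =>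
  \sum_(k : 'X_{1..n < (mdeg m).+1, (mdeg m).+1} | m == (k.1 + k.2)%MM)
    fps_coef f k.1 * fps_coef g k.2).

Fact fps_addA : associative fps_add.
Proof. by move=> f g h; apply: mfpsP => m /=; rewrite addrA. Qed.
Fact fps_addC : commutative fps_add.
Proof. by move=> f g; apply: mfpsP => m /=; rewrite addrC. Qed.
Fact fps_add0 : left_id (fps_const 0) fps_add.
Proof. by move=> f; apply: mfpsP => m /=; rewrite mul0rn add0r. Qed.
Fact fps_addN : left_inverse (fps_const 0) fps_opp fps_add.
Proof. by move=> f; apply: mfpsP => m /=; rewrite mul0rn addNr. Qed.

HB.instance Definition _ :=
  GRing.isZmodule.Build (mfps R n) fps_addA fps_addC fps_add0 fps_addN.

Let tr d f : {mpoly R[n]} := \sum_(k : 'X_{1..n < d}) fps_coef f k *: 'X_[k].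

Let coef_tr d f m : (mdeg m < d)%N -> (tr d f)@_m = fps_coef f m.
Proof.
move=> lt_md; rewrite raddf_sum (bigD1 (BMultinom lt_md)) //=.
rewrite mcoeffZ mcoeffX eqxx mulr1 big1 ?addr0 // => k ne_k.
by rewrite mcoeffZ mcoeffX -[m]/(bmnm (BMultinom lt_md)) -bmeqP (negbTE ne_k) mulr0.
Qed.

Let mcoeffM_eq (p p' q q' : {mpoly R[n]}) m :
  (forall k, (mdeg k <= mdeg m)%N -> p@_k = p'@_k) ->
  (forall k, (mdeg k <= mdeg m)%N -> q@_k = q'@_k) ->
  (p * q)@_m = (p' * q')@_m.
Proof.
move=> pp qq; rewrite !mcoeffM; apply: eq_bigr => -[k1 k2] /= _.
by rewrite pp ?qq // -ltnS bmdeg.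
Qed.

Let coefM_tr f g m d : (mdeg m < d)%N ->
  fps_coef (fps_mul f g) m = (tr d f * tr d g)@_m.
Proof.
move=> lt_md; rewrite mcoeffM /=; apply: eq_bigr => -[k1 k2] /= _.
by rewrite !coef_tr // (leq_trans _ lt_md) // bmdeg.
Qed.

Fact fps_mulC : commutative fps_mul.
Proof.
by move=> f g; apply: mfpsP => m; rewrite !(coefM_tr _ _ (ltnSn _)) mulrC.
Qed.

Fact fps_mulA : associative fps_mul.
Proof.
move=> f g h; apply: mfpsP => m; rewrite !(coefM_tr _ _ (ltnSn _)).
transitivity ((tr (mdeg m).+1 f * (tr (mdeg m).+1 g * tr (mdeg m).+1 h))@_m).
  by apply: mcoeffM_eq => // k le_k; rewrite coef_tr // (coefM_tr _ _ (d := (mdeg m).+1)).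
rewrite mulrA; apply: mcoeffM_eq => // k le_k.
by rewrite coef_tr // (coefM_tr _ _ (d := (mdeg m).+1)).
Qed.

Let coef_constM c f m : fps_coef (fps_mul (fps_const c) f) m = c * fps_coef f m.
Proof.
rewrite (coefM_tr _ _ (ltnSn _)).
transitivity ((c%:MP * tr (mdeg m).+1 f)@_m).
  by apply: mcoeffM_eq => // k le_k; rewrite coef_tr //= mcoeffC mulr_natr eq_sym.
by rewrite mcoeffCM coef_tr.
Qed.

Fact fps_mul1 : left_id (fps_const 1) fps_mul.
Proof. by move=> f; apply: mfpsP => m; rewrite coef_constM mul1r. Qed.

Fact fps_mulDl : left_distributive fps_mul fps_add.
Proof.
move=> f g h; apply: mfpsP => m /=; rewrite -big_split /=.
by apply: eq_bigr => k _; rewrite mulrDl.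
Qed.

Fact fps_one_neq0 : fps_const 1 != 0.
Proof.
apply/eqP => /(congr1 (fun f : mfps R n => fps_coef f 0%MM)) /=.
by rewrite eqxx mul0rn; apply/eqP/oner_neq0.
Qed.

HB.instance Definition _ := GRing.Zmodule_isComNzRing.Build (mfps R n)
  fps_mulA fps_mulC fps_mul1 fps_mulDl fps_one_neq0.

Lemma coef_fps0 m : fps_coef (0 : mfps R n) m = 0.
Proof. exact: mul0rn. Qed.
Lemma coef_fps1 m : fps_coef (1 : mfps R n) m = (m == 0%MM)%:R.
Proof. by []. Qed.
Lemma coef_fpsD f g m : fps_coef (f + g) m = fps_coef f m + fps_coef g m.
Proof. by []. Qed.
Lemma coef_fpsN f m : fps_coef (- f) m = - fps_coef f m.
Proof. by []. Qed.
Lemma coef_fpsM f g m : fps_coef (f * g) m =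
  \sum_(k : 'X_{1..n < (mdeg m).+1, (mdeg m).+1} | m == (k.1 + k.2)%MM)
    fps_coef f k.1 * fps_coef g k.2.
Proof. by []. Qed.

Lemma coef_fpsCM c f m : fps_coef (fps_const c * f) m = c * fps_coef f m.
Proof. exact: coef_constM. Qed.

Lemma coef0_fpsM f g :
  fps_coef (f * g) 0%MM = fps_coef f 0%MM * fps_coef g 0%MM.
Proof.
rewrite (coefM_tr f g (ltnSn _)) -!(coef_tr (d := (@mdeg n 0%MM).+1)) //.
exact: (rmorphM (mcoeff 0%MM)).
Qed.

Definition fps_eqmod d f g :=
  forall m, (mdeg m <= d)%N -> fps_coef f m = fps_coef g m.

Lemma fps_eqmodM d f f' g g' :
  fps_eqmod d f f' -> fps_eqmod d g g' -> fps_eqmod d (f * g) (f' * g').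
Proof.
move=> ff gg m le_md; rewrite !coef_fpsM; apply: eq_bigr => -[k1 k2] /= _.
by rewrite ff ?gg // (leq_trans _ le_md) // -ltnS bmdeg.
Qed.

Definition fps_ord_ge d f := forall m, (mdeg m < d)%N -> fps_coef f m = 0.

Lemma fps_ord_geM d e f g :
  fps_ord_ge d f -> fps_ord_ge e g -> fps_ord_ge (d + e) (f * g).
Proof.
move=> of_ og m lt_m; rewrite coef_fpsM big1 // => -[k1 k2] /= /eqP def_m.
case: (ltnP (mdeg k1) d) => [/of_ ->|le1]; first by rewrite mul0r.
case: (ltnP (mdeg k2) e) => [/og ->|le2]; first by rewrite mulr0.
suff : (d + e <= mdeg m)%N by rewrite leqNgt lt_m.
by rewrite {1}def_m mdegD leq_add.
Qed.

Lemma fps_ord_geX d f : fps_ord_ge 1 f -> fps_ord_ge d (f ^+ d).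
Proof.
move=> of_; elim: d => [|d IHd]; first by [].
by rewrite exprS -add1n; apply: fps_ord_geM.
Qed.

Definition fps_var (i : 'I_n) : mfps R n := MFPS (fun m => (m == U_(i)%MM)%:R).

End Ring.

Section UnitRing.
Variables (R : comUnitRingType) (n : nat).
Implicit Types (f g h : mfps R n) (m : 'X_{1..n}).

Definition fps_unit : pred (mfps R n) :=
  fun f => fps_coef f 0%MM \is a GRing.unit.

(* Geometric series: writing f = c (1 - h) with c the constant coefficient,   *)
(* h ^+ k only has monomials of degree at least k.                            *)
Definition fps_inv f : mfps R n :=
  let c := fps_coef f 0%MM in
  let h := 1 - fps_const n c^-1 * f in
  if c \is a GRing.unit then
    MFPS (fun m => c^-1 * fps_coef (\sum_(k < (mdeg m).+1) h ^+ k) m)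
  else f.

Fact fps_mulV : {in fps_unit, left_inverse 1 fps_inv *%R}.
Proof.
move=> f; rewrite unfold_in /fps_unit => Uc; rewrite mulrC /fps_inv Uc.
set c := fps_coef f _; rewrite -/c in Uc *; set h := 1 - _.
have oh : fps_ord_ge 1 h.
  move=> m; rewrite ltnS leqn0 mdeg_eq0 => /eqP ->.
  by rewrite coef_fpsD coef_fpsN coef_fpsCM coef_fps1 eqxx mulVr ?subrr.
have ohX d m : (mdeg m < d)%N -> fps_coef (h ^+ d) m = 0 by exact: fps_ord_geX.
apply: mfpsP => m; pose d := mdeg m.
transitivity (fps_coef (f * (fps_const n c^-1 * \sum_(k < d.+1) h ^+ k)) m).
  apply: (@fps_eqmodM _ _ d) => // k le_kd; rewrite coef_fpsCM [LHS]/=; congr (_ * _).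
  have cS e : fps_coef (\sum_(i < e) h ^+ i) k = \sum_(i < e) fps_coef (h ^+ i) k.
    by apply: (big_morph (fun g => fps_coef g k)) => //; apply: coef_fps0.
  rewrite !cS (big_ord_widen d.+1 (fun i => fps_coef (h ^+ i) k)) ?ltnS //.
  rewrite big_mkcond; apply: eq_bigr => i _; case: ifPn => //.
  by rewrite -leqNgt => /ohX ->.
have -> : f * (fps_const n c^-1 * \sum_(k < d.+1) h ^+ k) = 1 - h ^+ d.+1.
  rewrite -[1 - _]opprB subrX1 -mulNr opprB mulrA; congr (_ * _).
  by rewrite /h opprD addrA subrr sub0r opprK mulrC.
by rewrite coef_fpsD coef_fpsN ohX ?ltnSn // subr0.
Qed.

Fact fps_unitP f g : g * f = 1 -> fps_unit f.
Proof.
move=> /(congr1 (fun h => fps_coef h 0%MM)); rewrite coef0_fpsM coef_fps1 eqxx.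
by move=> gf1; apply/unitrPr; exists (fps_coef g 0%MM); rewrite mulrC.
Qed.

Fact fps_inv_out : {in [predC fps_unit], fps_inv =1 id}.
Proof. by move=> f; rewrite inE unfold_in /fps_unit /fps_inv => /negbTE ->. Qed.

HB.instance Definition _ := GRing.ComNzRing_hasMulInverse.Build (mfps R n)
  fps_mulV fps_unitP fps_inv_out.

End UnitRing.

(******************************************************************************)
(* Unordered infinite products: coefficientwise (eventually constant) limit   *)
(* of the finite subproducts, directed by inclusion.                          *)
(******************************************************************************)

Section InfProd.
Variables (R : comNzRingType) (n : nat) (T : choiceType).
Variables (P : T -> Prop) (F : T -> mfps R n).

Definition is_infprod (Z : mfps R n) : Prop :=
  forall m : 'X_{1..n}, exists S0 : seq T, forall S : seq T,
    uniq S -> {subset S0 <= S} ->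
    fps_coef (\prod_(c <- S | `[< P c >]) F c) m = fps_coef Z m.

(* The junk value 1 is used only when the product does not converge.          *)
Definition infprod : mfps R n :=
  if pselect (exists Z, is_infprod Z) is left cvgF then projT1 (cid cvgF) else 1.

Lemma is_infprod_unique Z Z' : is_infprod Z -> is_infprod Z' -> Z = Z'.
Proof.
move=> ZP ZP'; apply: mfpsP => m.
have [[S0 SP] [S0' SP']] := (ZP m, ZP' m).
rewrite -(SP (undup (S0 ++ S0'))) ?undup_uniq //.
  by apply: SP'; rewrite ?undup_uniq // => x xS; rewrite mem_undup mem_cat xS orbT.
by move=> x xS; rewrite mem_undup mem_cat xS.
Qed.

Lemma infprodP : (exists Z, is_infprod Z) -> is_infprod infprod.
Proof. by rewrite /infprod; case: pselect => // e _; case: cid. Qed.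

Lemma infprod_cvg :
  (forall d, exists S0 : seq T,
     forall c, P c -> c \notin S0 -> fps_eqmod d (F c) 1) ->
  is_infprod infprod.
Proof.
move=> cvgF; apply: infprodP.
pose S d := undup (sval (cid (cvgF d))).
have SP d c : P c -> c \notin S d -> fps_eqmod d (F c) 1.
  by rewrite mem_undup; apply: (svalP (cid (cvgF d))).
exists (MFPS (fun m => fps_coef (\prod_(c <- S (mdeg m) | `[< P c >]) F c) m)).
move=> m; exists (S (mdeg m)) => s Us sub.
rewrite (bigID (mem (S (mdeg m)))) /=.
set X := \prod_(_ <- _ | _) _; set Y := \prod_(_ <- _ | _) _.
have -> : X = \prod_(c <- S (mdeg m) | `[< P c >]) F c.
  rewrite /X -big_filter_cond -big_filter.
  rewrite (@perm_big _ _ _ _ _ [seq c <- S (mdeg m) | `[< P c >]]) ?big_filter //.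
  apply: uniq_perm; rewrite ?filter_uniq ?undup_uniq // => c.
  rewrite !mem_filter; case cS: (c \in S _); rewrite ?andbF //=.
  by rewrite (sub _ cS) !andbT.
transitivity (fps_coef ((\prod_(c <- S (mdeg m) | `[< P c >]) F c) * 1) m).
  apply: (@fps_eqmodM _ _ (mdeg m)) => // {X}.
  rewrite /Y; apply: (big_ind (fun f => fps_eqmod (mdeg m) f 1)) => //.
    by move=> f g f1 g1; rewrite -[1]mulr1; apply: fps_eqmodM.
  by move=> c /andP[/asboolP Pc /SP]; apply.
by rewrite mulr1.
Qed.

End InfProd.

(******************************************************************************)
(* Graphs with numbered edges                                                 *)
(******************************************************************************)

Definition graph (V : finType) (n : nat) := 'I_n -> {set V}.

Definition simple_graph (V : finType) (n : nat) (X : graph V n) : Prop :=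
  (forall i, #|X i| = 2%N) /\ injective X.

Section Cycles.
Variables (V : finType) (n : nat) (X : graph V n).
Implicit Types G T : seq 'I_n.

(* The witness w lists the edges of G directed, as pairs (origin, terminus);  *)
(* path.cycle includes the condition from the last edge to the first one.     *)
Definition is_cycle G : bool :=
  (G != [::]) &&
  [exists w : (size G).-tuple (V * V),
     ([seq [set d.1; d.2] | d <- w] == [seq X i | i <- G])
     && path.cycle [rel d d' : V * V | d.2 == d'.1] w].

Definition backtrackless G : bool := sorted (fun i j => i != j) G.

Definition tailless G : bool := if G is i :: G' then i != last i G' else true.

Definition primitive G : Prop :=
  ~ exists T r, [/\ is_cycle T, (2 <= r)%N & G = flatten (nseq r T)].

Definition prime_cycle G : Prop :=
  [/\ is_cycle G, backtrackless G, tailless G & primitive G].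

End Cycles.

Section CycleClasses.
Variable n : nat.
Implicit Types G : seq 'I_n.

Definition shift_equiv : rel (seq 'I_n) :=
  fun G G' => [exists k : 'I_(size G).+1, G' == rot k G].

Lemma shift_equivP G G' : reflect (exists k, G' = rot k G) (shift_equiv G G').
Proof.
apply: (iffP existsP) => [[k /eqP ->]|[k ->]]; first by exists k.
case: (ltnP k (size G).+1) => [lt_k|le_k]; first by exists (Ordinal lt_k).
by exists ord0; rewrite rot_oversize ?rot0 // ltnW.
Qed.

Lemma shift_equiv_refl : reflexive shift_equiv.
Proof. by move=> G; apply/shift_equivP; exists 0%N; rewrite rot0. Qed.

Lemma shift_equiv_symm : ssrbool.symmetric shift_equiv.
Proof.
move=> G G'; apply/shift_equivP/shift_equivP => -[k ->].
  by exists (size (rot k G) - k)%N; rewrite -/(rotr k _) rotK.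
by exists (size (rot k G') - k)%N; rewrite -/(rotr k _) rotK.
Qed.

Lemma shift_equiv_trans : transitive shift_equiv.
Proof.
move=> G2 G1 G3 /existsP[k /eqP ->] /existsP[l /eqP ->]; apply/shift_equivP.
have le_l : (l <= size G1)%N by have := ltn_ord l; rewrite [X in (_ < X.+1)%N]size_rot.
have le_k : (k <= size G1)%N by rewrite -ltnS.
by rewrite rot_add_mod //; eexists.
Qed.

Canonical shift_equiv_equiv :=
  EquivRel shift_equiv shift_equiv_refl shift_equiv_symm shift_equiv_trans.

Definition cycle_class := {eq_quot shift_equiv}.
HB.instance Definition _ := Choice.on cycle_class.
HB.instance Definition _ := EqQuotient.on cycle_class.

Definition cycle_monomial G : mfps int n := \prod_(i <- G) fps_var int i.

Lemma cycle_monomial_pi G :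
  cycle_monomial (repr (\pi_cycle_class G)) = cycle_monomial G.
Proof.
have : shift_equiv G (repr (\pi_cycle_class G)).
  by apply/eqmodP; rewrite reprK.
case/shift_equivP => k ->; apply: perm_big.
by rewrite perm_rot.
Qed.

Lemma cycle_monomial_ord G : fps_ord_ge (size G) (cycle_monomial G).
Proof.
elim: G => [|i G IHG]; first by [].
rewrite /cycle_monomial big_cons /= -add1n; apply: fps_ord_geM => // m.
rewrite ltnS leqn0 mdeg_eq0 => /eqP -> /=.
by rewrite eq_sym -mdeg_eq0 mdeg1.
Qed.

End CycleClasses.

Section Zeta.
Variables (V : finType) (n : nat) (X : graph V n).

Definition prime_class (c : cycle_class n) : Prop :=
  exists2 G, prime_cycle X G & c = \pi_(cycle_class n) G.

(* The representative is irrelevant by cycle_monomial_pi.                     *)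
Definition edge_zeta : mfps int n :=
  infprod prime_class (fun c => (1 - cycle_monomial (repr c))^-1).

Lemma edge_zeta_cvg : is_infprod prime_class
  (fun c => (1 - cycle_monomial (repr c))^-1) edge_zeta.
Proof.
apply: infprod_cvg => d.
pose S0 := [seq \pi_(cycle_class n) (tval t)
             | k <- iota 0 d.+1, t <- enum {: k.-tuple 'I_n}].
exists S0 => c [G [cG _ _ _] ->]; rewrite cycle_monomial_pi => nS0.
have lt_dG : (d < size G)%N.
  rewrite ltnNge; apply: contra nS0 => le_Gd.
  apply/allpairsPdep; exists (size G), (in_tuple G).
  by rewrite mem_iota mem_enum.
have og m : (mdeg m <= d)%N -> fps_coef (cycle_monomial G) m = 0.
  by move=> le_m; apply: cycle_monomial_ord; apply: leq_ltn_trans lt_dG.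
set f := 1 - _.
have f1 : fps_eqmod d f 1.
  by move=> m /og g0; rewrite coef_fpsD coef_fpsN g0 subr0.
have Uf : f \is a GRing.unit.
  rewrite unfold_in /= /fps_unit f1 ?mdeg0 //.
  by rewrite coef_fps1 eqxx unitr1.
rewrite -[f^-1]mulr1 -[X in fps_eqmod d _ X](mulVr Uf).
by apply: fps_eqmodM => // m le_m; rewrite f1.
Qed.

End Zeta.

(******************************************************************************)
(* Codes, normal graphs, covers                                               *)
(******************************************************************************)

Section Codes.
Variables (r n : nat) (H : 'M['F_2]_(r, n)).

Definition bit_nbrs (i : 'I_n) : {set 'I_r} := [set j | H j i == 1].
Definition check_nbrs (j : 'I_r) : {set 'I_n} := [set i | H j i == 1].

Definition code : {set 'rV['F_2]_n} :=
  [set x : 'rV['F_2]_n | [forall j, \sum_(i in check_nbrs j) x 0 i == 0]].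

Definition cycle_code (C : {set 'rV['F_2]_n}) : Prop :=
  C = code /\ forall i, #|bit_nbrs i| = 2%N.

Definition normal_graph : graph 'I_r n := bit_nbrs.

(* An M-fold cover of the Tanner graph of H is given by permutations pi j i;  *)
(* only those with i \in check_nbrs j are ever used.                          *)
Definition cover_code (M : nat) (pi : 'I_r -> 'I_n -> 'S_M) :
    {set 'M['F_2]_(n, M)} :=
  [set c : 'M['F_2]_(n, M) |
    [forall j, forall m, \sum_(i in check_nbrs j) c i (pi j i m) == 0]].

Definition unscaled_pseudocodeword (p : 'I_n -> nat) : Prop :=
  exists (M : nat) (pi : 'I_r -> 'I_n -> 'S_M) (c : 'M['F_2]_(n, M)),
    [/\ (0 < M)%N, c \in cover_code pi
      & forall i, p i = (\sum_(m < M) (c i m : nat))%N].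

End Codes.

(* Main.v *)
(** The coefficients of the factors [(1 - g(Γ))^-1] are nonnegative, so no
    cancellation occurs: [u^p] occurs in the zeta function iff [p] is a sum of
    exponent vectors of backtrackless tailless primitive cycles.  A codeword of
    a cover is an edge set of the covering graph with all degrees even.  It
    splits into edge-disjoint closed trails, and each of them projects to a
    backtrackless tailless cycle of [N], hence to a power of a primitive one.
    Conversely, disjoint unions of covers add pseudo-codewords, and every
    backtrackless tailless cycle lifts to a simple cycle of some cover. *)
Require Import Defs.
From mathcomp Require Import all_boot all_order all_algebra.
From mathcomp Require Import perm generic_quotient mpoly boolp.

Set Implicit Arguments.
Unset Strict Implicit.
Unset Printing Implicit Defensive.

Import Order.TTheory GRing.Theory Num.Theory.
Local Open Scope ring_scope.
Local Open Scope quotient_scope.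

(** * Exponent vectors of cycles and coefficients of geometric series *)

Definition mnm_of_seq n (G : seq 'I_n) : 'X_{1..n} := (\sum_(i <- G) U_(i))%MM.

Lemma mnm_of_seqE n (G : seq 'I_n) i : mnm_of_seq G i = count_mem i G.
Proof.
rewrite /mnm_of_seq; elim: G => [|j G IH]; first by rewrite big_nil mnm0E.
by rewrite big_cons mnmDE IH mnm1E.
Qed.

(** The monomial [g] is given only through its coefficients, so that the lemma serves both a single
    variable and a whole cycle monomial. *)
Lemma coef_fps_monoM n (a m : 'X_{1..n}) (f g : mfps int n) :
  (forall m', fps_coef g m' = (m' == a)%:R) ->
  fps_coef (g * f) (a + m)%MM = fps_coef f m.
Proof.
move=> gE; rewrite coef_fpsM.
have la : (mdeg a < (mdeg (a + m)).+1)%N by rewrite mdegD ltnS leq_addr.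
have lm : (mdeg m < (mdeg (a + m)).+1)%N by rewrite mdegD ltnS leq_addl.
rewrite (bigD1 (BMultinom la, BMultinom lm)) //= gE eqxx mul1r.
rewrite big1 ?addr0 // => -[[k1 lk1] [k2 lk2]] /= /andP[/eqP eqk ne].
rewrite gE; case: eqP => [eqa|_]; last by rewrite mul0r.
move: eqk; rewrite eqa => /(congr1 (fun x => (x - a)%MM)).
rewrite !(addmC a) !addmK => eqm; case/negP: ne.
by apply/eqP; congr (_, _); apply/val_inj; rewrite /= ?eqa ?eqm.
Qed.

Lemma coef_fpsM_neq0 n (f g : mfps int n) m : fps_coef (f * g) m != 0 ->
  exists k1 k2, [/\ m = (k1 + k2)%MM, fps_coef f k1 != 0 & fps_coef g k2 != 0].
Proof.
rewrite coef_fpsM => nz; apply: contrapT => no; case/negP: nz.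
apply/eqP/big1 => -[k1 k2] /= /eqP eqm; apply/eqP; apply: contrapT => /negP.
by rewrite mulf_eq0 => /norP[nz1 nz2]; apply: no; exists (bmnm k1), (bmnm k2).
Qed.

Lemma coef_cycle_monomial n (G : seq 'I_n) m :
  fps_coef (cycle_monomial G) m = (m == mnm_of_seq G)%:R.
Proof.
rewrite /cycle_monomial /mnm_of_seq; elim: G m => [|i G IH] m.
  by rewrite !big_nil coef_fps1.
rewrite !big_cons; set a := (\sum_(_ <- _) _)%MM in IH *.
case: eqP => [->|ne]; first by rewrite coef_fps_monoM // IH eqxx.
apply/eqP; apply: contrapT => /negP /coef_fpsM_neq0[k1 [k2 [eqm]]].
rewrite IH /= !pnatr_eq0 !eqb0 !negbK => /eqP e1 /eqP e2.
by case: ne; rewrite eqm e1 e2.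
Qed.

Lemma cycle_monomial_geom n (G : seq 'I_n) : G != [::] ->
  (1 - cycle_monomial G) * (1 - cycle_monomial G)^-1 = 1.
Proof.
move=> nzG; apply: mulrV; rewrite unfold_in /= /fps_unit.
rewrite coef_fpsD coef_fpsN coef_fps1 eqxx cycle_monomial_ord ?subr0 ?unitr1 //.
by rewrite mdeg0 lt0n size_eq0.
Qed.

Lemma cycle_monomial_geomE n (G : seq 'I_n) : G != [::] ->
  (1 - cycle_monomial G)^-1 = 1 + cycle_monomial G * (1 - cycle_monomial G)^-1.
Proof.
move=> /cycle_monomial_geom; rewrite mulrBl mul1r => /eqP.
by rewrite subr_eq => /eqP.
Qed.

Definition fps_ge0 n (f : mfps int n) := forall m, 0 <= fps_coef f m.

Lemma fps_ge0M n (f g : mfps int n) : fps_ge0 f -> fps_ge0 g -> fps_ge0 (f * g).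
Proof.
by move=> f0 g0 m; rewrite coef_fpsM; apply: sumr_ge0 => k _; apply: mulr_ge0.
Qed.

Lemma mdeg_mnm_of_seq n (G : seq 'I_n) : mdeg (mnm_of_seq G) = size G.
Proof.
rewrite /mnm_of_seq; elim: G => [|i G IH]; first by rewrite big_nil mdeg0.
by rewrite big_cons mdegD mdeg1 IH.
Qed.

(** Strong induction on the degree, using [1/(1-g) = 1 + g/(1-g)] and the positive degree of [g].
    The predicate sees both exponent and coefficient, so sign and support can be treated at once. *)
Lemma coef_geom_ind n (G : seq 'I_n) (P : 'X_{1..n} -> int -> Prop) :
  G != [::] -> (forall m, P m 0) -> P 0%MM 1 ->
  (forall m x, P m x -> P (mnm_of_seq G + m)%MM x) ->
  forall m, P m (fps_coef (1 - cycle_monomial G)^-1 m).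
Proof.
move=> nzG P0 P1 PD m; have [d] := ubnP (mdeg m); elim: d m => // d IH m lem.
have G_gt0 : (0 < size G)%N by rewrite lt0n size_eq0.
rewrite cycle_monomial_geomE // coef_fpsD coef_fps1; set f := _^-1 in IH *.
(* Either only the summand 1 can contribute at [m], or the exponent of [G] splits off [m]; in the
   latter case [m] is nonzero and 1 contributes nothing. *)
have [nz|/negPn/eqP ->] := boolP (fps_coef (cycle_monomial G * f) m != 0); last first.
  by rewrite addr0; case: eqP => [->|_].
have [k1 [k2 [eqm]]] := coef_fpsM_neq0 nz.
rewrite coef_cycle_monomial pnatr_eq0 eqb0 negbK => /eqP k1E _; subst m k1.
rewrite coef_fps_monoM; last exact: coef_cycle_monomial.
rewrite -mdeg_eq0 mdegD mdeg_mnm_of_seq addn_eq0 -leqn0 leqNgt G_gt0 add0r.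
apply/PD/IH; move: lem; rewrite mdegD mdeg_mnm_of_seq ltnS; apply: leq_trans.
by rewrite -{1}[mdeg k2]add0n ltn_add2r.
Qed.

(** * The support of the edge zeta function *)

Section Zeta.
Variables (V : finType) (n : nat) (X : graph V n).

(** A list, because the same cycle may be taken several times. *)
Definition prime_sum (p : 'X_{1..n}) : Prop :=
  exists2 s : seq (seq 'I_n), {in s, forall G, prime_cycle X G}
    & p = (\sum_(G <- s) mnm_of_seq G)%MM.

Lemma prime_sum0 : prime_sum 0%MM.
Proof. by exists [::]; rewrite ?big_nil. Qed.

Lemma prime_sumD p q : prime_sum p -> prime_sum q -> prime_sum (p + q)%MM.
Proof.
move=> [s sP ->] [t tP ->]; exists (s ++ t); last by rewrite big_cat.
by move=> G; rewrite mem_cat => /orP[/sP|/tP].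
Qed.

Lemma prime_sum1 G : prime_cycle X G -> prime_sum (mnm_of_seq G).
Proof. by exists [:: G]; rewrite ?big_seq1 // => G'; rewrite inE => /eqP ->. Qed.

Lemma prime_cycle_neq_nil G : prime_cycle X G -> G != [::].
Proof. by case=> /andP[]. Qed.

Let F (c : cycle_class n) := (1 - cycle_monomial (repr c))^-1.

(** The support half passes through products without any sign condition; nonnegativity is recorded
    because it excludes cancellation when a nonzero coefficient has to be produced. *)
Lemma coef_prod_prime_class S m (f := \prod_(c <- S | `[< prime_class X c >]) F c) :
  (0 <= fps_coef f m) && ((fps_coef f m != 0) ==> `[< prime_sum m >]).
Proof.
rewrite {}/f; elim/big_ind: _ m => [m|f g IHf IHg m|c /asboolP[G GP ->] m].
- rewrite coef_fps1; case: eqP => //= ->; apply/asboolP; exact: prime_sum0.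
- have ge0 h : (forall m, (0 <= fps_coef h m) &&
      ((fps_coef h m != 0) ==> `[< prime_sum m >])) -> fps_ge0 h.
    by move=> hP k; case/andP: (hP k).
  apply/andP; split; first exact: fps_ge0M (ge0 _ IHf) (ge0 _ IHg) m.
  apply/implyP => /coef_fpsM_neq0[k1 [k2 [->]]].
  have [/andP[_ /implyP h1] /andP[_ /implyP h2]] := (IHf k1, IHg k2).
  move=> /h1/asboolP p1 /h2/asboolP p2; apply/asboolP; exact: prime_sumD.
rewrite /F cycle_monomial_pi.
apply: (coef_geom_ind (G := G) (P := fun m x =>
  (0 <= x) && ((x != 0) ==> `[< prime_sum m >]))).
- exact: prime_cycle_neq_nil GP.
- by move=> k; rewrite lexx eqxx.
- by rewrite ler01; apply/implyP => _; apply/asboolP; exact: prime_sum0.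
move=> k x /andP[-> /implyP xP]; apply/implyP => /xP /asboolP mP.
by apply/asboolP/prime_sumD => //; apply: prime_sum1.
Qed.

Lemma coef_edge_zeta_neq0 p :
  fps_coef (edge_zeta X) p != 0 <-> prime_sum p.
Proof.
have [S0 S0P] := edge_zeta_cvg X p; split.
  rewrite -(S0P (undup S0)) ?undup_uniq // => [|c]; last by rewrite mem_undup.
  have /andP[_ /implyP h] := coef_prod_prime_class (undup S0) p.
  by move=> /h /asboolP.
move=> [s sP pE]; subst p; pose S := undup (S0 ++ [seq \pi_(cycle_class n) G | G <- s]).
rewrite -(S0P S) ?undup_uniq // => [|c cS]; last by rewrite mem_undup mem_cat cS.
have {S0P} sS: {subset [seq \pi_(cycle_class n) G | G <- s] <= S}.
  by move=> c cs; rewrite mem_undup mem_cat cs orbT.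
(* Strict positivity is proved, for every list [U] containing the classes of [s]: the list [S]
   itself depends on [s] and would block the induction. *)
rewrite gt_eqF //; move: (S) sS => {S} U; elim: s sP U => [|G s IH] sP U sU.
  rewrite big_nil.
  suff -> : fps_coef (\prod_(c <- U | `[< prime_class X c >]) F c) 0%MM = 1.
    exact: ltr01.
  apply: (big_ind (fun f => fps_coef f 0%MM = 1)) => [|f g f1 g1|c /asboolP[G GP ->]].
  - by rewrite coef_fps1 eqxx.
  - by rewrite coef0_fpsM f1 g1.
  have := congr1 (fun f => fps_coef f 0%MM)
    (cycle_monomial_geom (prime_cycle_neq_nil GP)).
  rewrite coef0_fpsM coef_fpsD coef_fpsN !coef_fps1 eqxx coef_cycle_monomial.
  rewrite eq_sym -mdeg_eq0 mdeg_mnm_of_seq size_eq0.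
  by rewrite (negPf (prime_cycle_neq_nil GP)) subr0 mul1r /F cycle_monomial_pi.
have GP : prime_cycle X G by apply: sP; rewrite mem_head.
have GU : \pi_(cycle_class n) G \in U by apply: sU; rewrite mem_head.
have PG : `[< prime_class X (\pi_(cycle_class n) G) >] by apply/asboolP; exists G.
pose f := \prod_(c <- rem (\pi_(cycle_class n) G) U | `[< prime_class X c >]) F c.
have UE : \prod_(c <- U | `[< prime_class X c >]) F c = (1 - cycle_monomial G)^-1 * f.
  by rewrite (perm_big _ (perm_to_rem GU)) big_cons PG /F cycle_monomial_pi.
have /andP[f_ge0 _] := coef_prod_prime_class (rem (\pi_(cycle_class n) G) U)
  (\sum_(j <- G :: s) mnm_of_seq j)%MM.
change (0 < fps_coef (\prod_(c <- U | `[< prime_class X c >]) F c)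
              (\sum_(j <- G :: s) mnm_of_seq j)%MM).
(* With [P] the product over [U] and [g] the monomial of [G], this reads [P = f + g P]. The full [P]
   reappears, so the remaining summands may use the class of [G] again. *)
rewrite UE cycle_monomial_geomE ?(prime_cycle_neq_nil GP) // mulrDl mul1r coef_fpsD.
apply: ltr_wpDl => //; rewrite -mulrA -UE big_cons.
rewrite coef_fps_monoM; last exact: coef_cycle_monomial.
apply: IH => [G' G's|c cs]; first by apply: sP; rewrite inE G's orbT.
by apply: sU; rewrite inE cs orbT.
Qed.
End Zeta.

(** * Cyclic nonbacktracking and reduction to primitive cycles *)

Definition nonbacktracking (T : eqType) (G : seq T) : bool :=
  path.cycle (fun i j => i != j) G.

Lemma nonbacktrackingE n (G : seq 'I_n) : G != [::] ->
  nonbacktracking G = backtrackless G && tailless G.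
Proof.
case: G => // i G _; rewrite /nonbacktracking /= rcons_path.
by congr (_ && _); rewrite eq_sym.
Qed.

(** The junction of two consecutive copies of [G] is exactly the wrap-around condition for [G]. *)
Lemma nonbacktracking_root (T : eqType) (G : seq T) r :
  nonbacktracking (flatten (nseq r.+2 G)) -> nonbacktracking G.
Proof.
case: G => // i G; rewrite /nonbacktracking /=.
by rewrite rcons_cat cat_path /= => /and3P[pG liG _]; rewrite rcons_path pG.
Qed.

(** A cycle that is not primitive is a power of a shorter one, which inherits nonbacktracking; its
    exponent vector is then a multiple of one covered by induction on the length. *)
Lemma cycle_prime_sum (V : finType) n (X : graph V n) (G : seq 'I_n) :
  is_cycle X G -> nonbacktracking G -> prime_sum X (mnm_of_seq G).
Proof.
have [d] := ubnP (size G); elim: d G => // d IH G ltG cG nbG.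
have nzG : G != [::] by case/andP: cG.
have [Gprim|/contrapT[T [r [cT r_ge2 GE]]]] := pselect (primitive X G).
  apply: prime_sum1; split=> //; move: nbG; rewrite nonbacktrackingE //.
    by case/andP.
  by case/andP.
have T_gt0 : (0 < size T)%N by rewrite lt0n size_eq0; case/andP: cT.
have psT : prime_sum X (mnm_of_seq T).
  case: r r_ge2 GE => [|[|r]] // _ GE; apply: IH => //; last first.
    by apply: (@nonbacktracking_root _ _ r); rewrite -GE.
  move: ltG; rewrite GE size_flatten /shape map_nseq sumn_nseq ltnS.
  by apply: leq_trans; rewrite -{1}[size T]muln1 ltn_pmul2l.
rewrite {}GE; elim: r {r_ge2} => [|r IHr].
  by rewrite /mnm_of_seq big_nil; apply: prime_sum0.
by rewrite /= /mnm_of_seq big_cat; apply: prime_sumD.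
Qed.

(** * Even edge sets and closed trails *)

Section EvenSubgraph.
Variables (W E : finType) (ends : E -> {set W}).
Hypothesis ends2 : forall e, #|ends e| = 2%N.

(** A dart records its edge as well, since [ends] is not assumed injective. *)
Notation dart := ((W * E * W)%type).
Definition dsrc (d : dart) := d.1.1.
Definition dedge (d : dart) := d.1.2.
Definition dtgt (d : dart) := d.2.

Definition is_dart (S : {set E}) (d : dart) : bool :=
  (dedge d \in S) && (ends (dedge d) == [set dsrc d; dtgt d]).

Definition dart_succ : rel dart :=
  fun d d' => (dtgt d == dsrc d') && (dedge d != dedge d').

Definition even_edges (S : {set E}) : Prop :=
  forall w, ~~ odd #|[set e in S | w \in ends e]|.

Lemma is_dart_neq S d : is_dart S d -> dsrc d != dtgt d.
Proof.
case/andP=> _ /eqP eE; have := ends2 (dedge d).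
by rewrite eE cards2; case: (_ != _).
Qed.

Lemma edge_is_dart (S : {set E}) e w : e \in S -> w \in ends e ->
  exists2 d, is_dart S d & (dsrc d = w) /\ (dedge d = e).
Proof.
move=> eS we; have /cards2P[x [y [ne eE]]] : #|ends e| == 2%N by apply/eqP.
move: we; rewrite eE => /set2P[->|->].
  by exists (x, e, y); rewrite // /is_dart eS /= eE eqxx.
by exists (y, e, x); rewrite // /is_dart eS /= eE setUC eqxx.
Qed.

(** The edge of arrival is one of an even number of edges of [S] at the target, so another one is
    available for leaving. *)
Lemma dart_succ_ex S d : even_edges S -> is_dart S d ->
  exists2 d', is_dart S d' & dart_succ d d'.
Proof.
move=> evS dS; have := evS (dtgt d); set A := [set e in S | _].
have dA : dedge d \in A.
  by case/andP: dS => dS /eqP eE; rewrite inE dS eE set22.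
rewrite (cardsD1 (dedge d)) dA /= negbK => oddA.
have /card_gt0P[e] : (0 < #|A :\ dedge d|)%N by case: #|_| oddA.
rewrite !inE => /and3P[ne eS we].
have [d' d'S [d'w d'e]] := edge_is_dart eS we.
by exists d' => //; rewrite /dart_succ d'w d'e eqxx eq_sym.
Qed.

(* Evenness lets any walk continue without backtracking; stop it at its first
   return to a visited vertex. *)
Lemma even_edges_trail S : even_edges S -> S != set0 ->
  exists ds : seq dart, [/\ ds != [::], all (is_dart S) ds,
    path.cycle dart_succ ds & uniq (map dedge ds)].
Proof.
move=> evS /set0Pn[e0 e0S].
have [w0 w0e] : exists w, w \in ends e0.
  by apply/set0Pn; rewrite -card_gt0 ends2.
have [d0 d0S _] := edge_is_dart e0S w0e.
pose nxt d := odflt d [pick d' | is_dart S d' && dart_succ d d'].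
have nxtP d : is_dart S d -> is_dart S (nxt d) && dart_succ d (nxt d).
  move=> dS; rewrite /nxt; case: pickP => //= none.
  by have [d' d'S dd'] := dart_succ_ex evS dS; have := none d'; rewrite d'S dd'.
have iter_dart d k : is_dart S d -> is_dart S (iter k nxt d).
  by move=> dS; elim: k => //= k /nxtP/andP[].
have [d [k [dS k_gt0 uniq_src ret]]] : exists d k,
    [/\ is_dart S d, (0 < k)%N, uniq (map dsrc (traject nxt d k))
      & dsrc (iter k nxt d) = dsrc d].
  (* Pigeonhole: more than [#|W|] sources cannot be distinct. *)
  have exN : exists b, ~~ uniq (map dsrc (traject nxt d0 b)).
    exists #|W|.+1; apply/negP => /card_uniqP.
    rewrite size_map size_traject => eqW.
    have := max_card (mem (map dsrc (traject nxt d0 #|W|.+1))).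
    by rewrite eqW ltnn.
  have [[//|b] nuniq minb] := ex_minnP exN.
  have ub : uniq (map dsrc (traject nxt d0 b)).
    by apply: contraT => /minb; rewrite ltnn.
  (* By minimality the first [b] sources are distinct, so the next one repeats the source at some
     index [a]; the segment from [a] to [b] is the closed walk. *)
  move: nuniq; rewrite trajectSr map_rcons rcons_uniq ub andbT negbK.
  case/mapP => x /trajectP[a ltab ->] eqab.
  exists (iter a nxt d0), (b - a)%N; split; first exact: iter_dart.
  - by rewrite subn_gt0.
  - move: ub; rewrite -(subnKC (ltnW ltab)).
    have trajD c m y :
      traject nxt y (c + m) = traject nxt y c ++ traject nxt (iter c nxt y) m.
      by elim: c y => //= c IH y; rewrite IH -iterS -iterSr.
    by rewrite trajD map_cat cat_uniq addKn => /and3P[].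
  by rewrite -iterD subnK ?(ltnW ltab).
pose v i := dsrc (iter i nxt d); pose ed i := dedge (iter i nxt d).
have endsE i : ends (ed i) = [set v i; v i.+1].
  have /andP[_ /eqP ->] := iter_dart d i dS.
  by have /andP[_ /andP[/eqP -> _]] := nxtP _ (iter_dart d i dS).
have v_neq i : v i != v i.+1.
  have := is_dart_neq (iter_dart d i dS).
  by have /andP[_ /andP[/eqP -> _]] := nxtP _ (iter_dart d i dS).
have ed_neq i : ed i != ed i.+1.
  by have /andP[_ /andP[_ ne]] := nxtP _ (iter_dart d i dS).
have v_inj i j : (i < k)%N -> (j < k)%N -> v i = v j -> i = j.
  move=> ik jk vij; apply/eqP.
  rewrite -(nth_uniq (dsrc d) _ _ uniq_src) ?size_map ?size_traject //.
  by rewrite !(nth_map d) ?size_traject // !nth_traject // -/(v i) -/(v j) vij.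
(* Equal edges have equal ends. As [v i] differs from [v j], it equals [v j.+1]; then [v i.+1] is
   [v j], which makes the two edges consecutive, or [v i] itself, which makes a loop. *)
have ed_inj i j : (i < j)%N -> (j < k)%N -> ed i != ed j.
  move=> ij jk; apply/eqP => eij.
  have : v i.+1 \in ends (ed j) by rewrite -eij endsE set22.
  have : v i \in ends (ed j) by rewrite -eij endsE set21.
  rewrite endsE => /set2P[/v_inj ii|vi].
    by have := ii (ltn_trans ij jk) jk => ii'; rewrite ii' ltnn in ij.
  case/set2P => [vj|vj].
    have ij1 : i.+1 = j by apply: v_inj => //; apply: leq_ltn_trans jk.
    by move/eqP: eij; rewrite -ij1; apply/negP.
  by have := v_neq i; rewrite vi vj eqxx.
have uniq_ed : uniq (map dedge (traject nxt d k)).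
  apply: contraT => /(uniqPn (dedge d))[i [j [ij]]].
  rewrite size_map size_traject => jk.
  rewrite !(nth_map d) ?size_traject ?(ltn_trans ij) // !nth_traject ?(ltn_trans ij) //.
  by move/eqP; rewrite (negPf (ed_inj i j ij jk)).
exists (traject nxt d k); split=> //; first by case: (k) k_gt0.
- by apply/allP => x /trajectP[i _ ->]; apply: iter_dart.
case: k k_gt0 ret v_inj ed_inj {uniq_src uniq_ed} => // k _ ret v_inj ed_inj.
rewrite trajectS /path.cycle rcons_path; apply/andP; split.
  apply/(pathP d) => i; rewrite size_traject => ik.
  rewrite -trajectS nth_traject ?(leqW ik) //.
  rewrite (set_nth_default (nxt d)) ?size_traject // nth_traject // -iterSr.
  by have /andP[] := nxtP _ (iter_dart d i dS).
rewrite last_traject /dart_succ.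
have /andP[_ /andP[/eqP -> _]] := nxtP _ (iter_dart d k dS).
rewrite -[dsrc (nxt _)]/(dsrc (iter k.+1 nxt d)) ret eqxx /=.
(* A closed walk with one step would be a loop; with more steps, its last and first edges differ by
   [ed_inj]. *)
case: k ret v_inj ed_inj => [|k] ret _ ed_inj; last first.
  by rewrite eq_sym; apply: (ed_inj 0%N).
by have := v_neq 0%N; rewrite /v ret eqxx.
Qed.

(** The degree at [w] counts darts leaving plus darts entering; the targets are the sources rotated
    by one, so the two counts agree. *)
Lemma trail_even S ds : all (is_dart S) ds -> path.cycle dart_succ ds ->
  uniq (map dedge ds) -> even_edges [set e in map dedge ds].
Proof.
move=> dsS cds uds w.
have tgtE : map dtgt ds = rot 1 (map dsrc ds).
  case: ds cds {dsS uds} => // d ds; rewrite /path.cycle /= rot1_cons.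
  elim: ds d {2 4}d => [|d' ds IH] d x /=; first by rewrite andbT => /andP[/eqP ->].
  by case/andP=> /andP[/eqP -> _] /IH ->.
have -> : #|[set e in [set e in map dedge ds] | w \in ends e]|
    = (count_mem w (map dsrc ds) + count_mem w (map dtgt ds))%N.
  transitivity (count (fun e => w \in ends e) (map dedge ds)).
    rewrite -size_filter -(card_uniqP _) ?filter_uniq //; apply: eq_card => e.
    by rewrite !inE mem_filter andbC.
  rewrite !count_map -count_predUI addnC.
  rewrite (_ : count (predI _ _) ds = 0%N) ?add0n.
    apply: eq_in_count => d /(allP dsS) /andP[_ /eqP /= ->].
    by rewrite !inE ![w == _]eq_sym.
  apply/eqP; rewrite -leqn0 leqNgt -has_count; apply/hasPn => d /(allP dsS) /is_dart_neq.
  by rewrite /=; apply: contra => /andP[/eqP -> /eqP ->].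
rewrite tgtE; have /seq.permP -> : perm_eq (rot 1 (map dsrc ds)) (map dsrc ds).
  by rewrite perm_rot.
by rewrite addnn odd_double.
Qed.

Lemma even_edgesD (S T : {set E}) :
  T \subset S -> even_edges S -> even_edges T -> even_edges (S :\: T).
Proof.
move=> TS evS evT w; have := evS w; rewrite -(cardsID T) oddD.
rewrite (_ : _ :&: _ = [set e in T | w \in ends e]) ?(negPf (evT w)) /=.
  rewrite (_ : _ :\: _ = [set e in S :\: T | w \in ends e]) //.
  by apply/setP => e; rewrite !inE andbA.
apply/setP => e; rewrite !inE andbAC; congr (_ && _).
by apply/andP/idP => [[]|eT] //; split; rewrite // (subsetP TS).
Qed.

End EvenSubgraph.

(** * Projection of closed trails from a cover to the normal graph *)

Section CoverToPrimes.
Variables (r n : nat) (H : 'M['F_2]_(r, n)).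
Hypothesis N_simple : simple_graph (normal_graph H).
Variables (M : nat) (pi : 'I_r -> 'I_n -> 'S_M).

(* The M-fold cover of the normal graph dual to the cover of the Tanner graph. *)
Definition cover_ends (e : 'I_n * 'I_M) : {set 'I_r * 'I_M} :=
  [set w | (w.1 \in bit_nbrs H e.1) && (pi w.1 e.1 w.2 == e.2)].

Lemma cover_ends_card e : #|cover_ends e| = 2%N.
Proof.
case: N_simple => X2 _; rewrite -(X2 e.1).
rewrite -(card_imset _ (f := fun j => (j, (pi j e.1)^-1%g e.2))).
  apply: eq_card => -[j m]; rewrite inE /=; apply/andP/imsetP => [[jX /eqP <-]|].
    by exists j; rewrite ?permK.
  by case=> j' j'X [-> ->]; rewrite permKV eqxx.
by move=> j j' [].
Qed.

(** Local injectivity of the covering map, the reason why nonbacktracking survives projection. *)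
Lemma cover_ends_inj w e e' : w \in cover_ends e -> w \in cover_ends e' ->
  e.1 = e'.1 -> e = e'.
Proof.
case: e e' => [i m] [i' m']; rewrite !inE /= => /andP[_ /eqP <-] /andP[_ /eqP <-].
by move=> ->.
Qed.

(** Two ends over the same vertex would lie on the same sheet, because the permutation there is
    injective. *)
Lemma cover_ends_proj e w w' : cover_ends e = [set w; w'] ->
  bit_nbrs H e.1 = [set w.1; w'.1].
Proof.
move=> eE; have := cover_ends_card e; rewrite eE => ww.
have ends_w x : x \in [set w; w'] -> x.1 \in bit_nbrs H e.1 /\ pi x.1 e.1 x.2 = e.2.
  by rewrite -eE inE => /andP[? /eqP].
have [[w1 w2] [w'1 w'2]] := (ends_w w (set21 _ _), ends_w w' (set22 _ _)).
apply/eqP; rewrite eq_sym eqEcard subUset !sub1set w1 w'1 /=.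
have [-> _] := N_simple; rewrite cards2.
move: ww; rewrite cards2; case: eqP => // ne _.
case: eqP => // e1; case: ne; move: w2 w'2; rewrite -e1 => <- /perm_inj e2.
by apply/eqP; rewrite -pair_eqE /pair_eq /= e1 e2 !eqxx.
Qed.

Lemma trail_proj_cycle S ds : ds != [::] -> all (is_dart cover_ends S) ds ->
  path.cycle (@dart_succ _ _) ds ->
  is_cycle (normal_graph H) [seq (dedge d).1 | d <- ds].
Proof.
move=> nz dsS cds; rewrite /is_cycle -size_eq0 size_map size_eq0 nz /=.
pose w := [seq ((dsrc d).1, (dtgt d).1) | d <- ds].
have sz : size w == size [seq (dedge d).1 | d <- ds] by rewrite !size_map.
rewrite -(size_map (fun d => (dedge d).1)).
apply/existsP; exists (Tuple sz); rewrite /=; apply/andP; split.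
  rewrite -!map_comp; apply/eqP/eq_in_map => d /(allP dsS)/andP[_ /eqP eE] /=.
  by rewrite /normal_graph (cover_ends_proj eE).
rewrite cycle_map; apply: sub_cycle cds => d d' /andP[/eqP e _] /=.
by rewrite e.
Qed.

Lemma trail_proj_nonbacktracking S ds : all (is_dart cover_ends S) ds ->
  path.cycle (@dart_succ _ _) ds ->
  nonbacktracking [seq (dedge d).1 | d <- ds].
Proof.
move=> dsS cds; rewrite /nonbacktracking cycle_map.
apply: (sub_in_cycle (P := mem ds)) cds; last exact/allP.
move=> d d' /(allP dsS)/andP[_ /eqP eE] /(allP dsS)/andP[_ /eqP eE'].
case/andP=> /eqP tE; apply: contra => /eqP e1; apply/eqP; move: e1.
apply: (cover_ends_inj (w := dtgt d)).
  by rewrite eE set22.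
by rewrite eE' tE set21.
Qed.

(** Removing a closed trail keeps all degrees even, so [S] is used up by induction on its size. The
    edges of the trail are distinct, hence summing over [T] is summing along the projected cycle. *)
Lemma even_edges_prime_sum (S : {set 'I_n * 'I_M}) : even_edges cover_ends S ->
  prime_sum (normal_graph H) (\sum_(e in S) U_(e.1))%MM.
Proof.
have [d] := ubnP #|S|; elim: d S => // d IH S ltS evS.
have [->|nzS] := eqVneq S set0; first by rewrite big_set0; apply: prime_sum0.
have [ds [nz dsS cds uds]] := even_edges_trail cover_ends_card evS nzS.
pose T := [set e in map (@dedge _ _) ds].
have TS : T \subset S.
  by apply/subsetP => e; rewrite inE => /mapP[x /(allP dsS)/andP[xS _] ->].
have evT : even_edges cover_ends T := trail_even cover_ends_card dsS cds uds.
rewrite (big_setID T) (setIidPr TS) /=; apply: prime_sumD; last first.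
  apply: IH; last exact: even_edgesD.
  move: ltS; rewrite -(cardsID T S) (setIidPr TS) ltnS; apply: leq_trans.
  rewrite -[X in (X < _)%N]add0n ltn_add2r.
  rewrite card_gt0; apply/set0Pn; case: ds nz {dsS cds uds TS evT} @T => // x ds _ T.
  by exists (dedge x); rewrite inE mem_head.
rewrite (_ : (\sum_(e in T) _)%MM = mnm_of_seq [seq (dedge d).1 | d <- ds]).
  apply: cycle_prime_sum; first exact: trail_proj_cycle dsS cds.
  exact: trail_proj_nonbacktracking dsS cds.
rewrite /mnm_of_seq big_map -(big_map (@dedge _ _) xpredT (fun e => U_(e.1)%MM)).
by rewrite big_uniq //; apply: eq_bigl => e; rewrite inE.
Qed.
End CoverToPrimes.

(** * Codewords of covers as even edge sets *)

Lemma F2_eq1 (x : 'F_2) : (x == 1) = (x : nat) :> nat.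
Proof. by case: x => [[|[|]]]. Qed.

Lemma F2_natE (x : 'F_2) : x = ((x == 1) : nat)%:R.
Proof. by case: x => [[|[|]]] // i; apply/val_inj. Qed.

Lemma F2_natr_eq0 k : (k%:R == 0 :> 'F_2) = ~~ odd k.
Proof. by rewrite -dvdn2 (dvdn_pcharf (pchar_Fp (p := 2) isT)). Qed.

Lemma pseudocodeword_prime_sum r n (H : 'M['F_2]_(r, n)) (p : 'X_{1..n}) :
  simple_graph (normal_graph H) ->
  unscaled_pseudocodeword H p -> prime_sum (normal_graph H) p.
Proof.
move=> N_simple [M [pi [c [_ cP pE]]]].
pose S := [set e : 'I_n * 'I_M | c e.1 e.2 == 1].
suff evS : even_edges (cover_ends H pi) S.
  rewrite (_ : p = (\sum_(e in S) U_(e.1))%MM); first exact: even_edges_prime_sum.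
  apply/mnmP => i; rewrite pE mnm_sumE.
  rewrite (eq_bigl (fun e : 'I_n * 'I_M => c e.1 e.2 == 1)); last first.
    by move=> e; rewrite inE.
  rewrite -(pair_big_dep xpredT (fun i m => c i m == 1)
    (fun i' _ => (U_(i')%MM i))) /=.
  rewrite (bigD1 i) //= [X in (_ + X)%N]big1 ?addn0.
    rewrite [RHS]big_mkcond; apply: eq_bigr => m _.
    by rewrite -F2_eq1 mnm1E eqxx; case: ifP.
  by move=> j /negPf ji; apply: big1 => m _; rewrite mnm1E ji.
(* The check equation at [(j, m)] sums [c] over the cover edges at that vertex, so it states that
   [S] has even degree there. *)
move=> [j m]; move: cP; rewrite inE => /forallP/(_ j)/forallP/(_ m).
under eq_bigr => i _ do rewrite (F2_natE (c i _)).
rewrite -natr_sum F2_natr_eq0; congr (~~ odd _).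
rewrite -big_mkcondr sum1_card.
rewrite -(card_imset _ (f := fun i => (i, pi j i m))); last by move=> i i' [].
apply: eq_card => -[i m']; rewrite !inE /=; apply/imsetP/idP => [[i']|].
  by rewrite unfold_in inE => /andP[ij /eqP ci] [-> ->]; rewrite ci ij !eqxx.
case/and3P=> ci ij /eqP mE; exists i; last by rewrite mE.
by rewrite unfold_in inE ij mE.
Qed.

(** The index modulo the size is the value of [ordS], which indexes closed walks below. *)
Lemma cycle_nth (T : Type) (e : rel T) (x0 : T) s i :
  path.cycle e s -> (i < size s)%N ->
  e (nth x0 s i) (nth x0 s (i.+1 %% size s)).
Proof.
case: s => // x s; rewrite /path.cycle => /(pathP x0); rewrite size_rcons.
move=> pxs lei; have := pxs i lei; rewrite -rcons_cons nth_rcons lei nth_rcons.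
move: lei; rewrite /= ltnS leq_eqVlt => /orP[/eqP ->|lti].
  by rewrite ltnn eqxx modnn.
by rewrite lti modn_small.
Qed.

(** * Blockwise permutations, for disjoint unions of covers *)

Section PermSum.
Variables (M1 M2 : nat) (s : 'S_M1) (t : 'S_M2).

Definition perm_sum_fun (x : 'I_(M1 + M2)) : 'I_(M1 + M2) :=
  match split x with inl a => lshift M2 (s a) | inr b => rshift M1 (t b) end.

Lemma perm_sum_fun_inj : injective perm_sum_fun.
Proof.
move=> x y; rewrite -[x]splitK -[y]splitK /perm_sum_fun !unsplitK.
case: (split x) (split y) => [a|a] [b|b] /= /eqP.
- by rewrite eq_lshift => /eqP/perm_inj ->.
- by rewrite eq_lrshift.
- by rewrite eq_rlshift.
- by rewrite eq_rshift => /eqP/perm_inj ->.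
Qed.

Definition perm_sum : 'S_(M1 + M2) := perm perm_sum_fun_inj.

Lemma perm_suml a : perm_sum (lshift M2 a) = lshift M2 (s a).
Proof. by rewrite permE /perm_sum_fun (unsplitK (inl a)). Qed.

Lemma perm_sumr b : perm_sum (rshift M1 b) = rshift M1 (t b).
Proof. by rewrite permE /perm_sum_fun (unsplitK (inr b)). Qed.
End PermSum.

(** * Pseudo-codewords from sums and from lifted closed walks *)

Section Pseudocodewords.
Variables (r n : nat) (H : 'M['F_2]_(r, n)).

Lemma pseudocodeword0 : unscaled_pseudocodeword H (0%MM : 'X_{1..n}).
Proof.
exists 1%N, (fun _ _ => 1%g), 0; split=> // [|i]; last first.
  by rewrite mnm0E big1 // => m _; rewrite mxE.
rewrite inE; apply/forallP => j; apply/forallP => m.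
by rewrite big1 // => i _; rewrite mxE.
Qed.

Lemma pseudocodewordD (p q : 'X_{1..n}) : unscaled_pseudocodeword H p ->
  unscaled_pseudocodeword H q -> unscaled_pseudocodeword H (p + q)%MM.
Proof.
move=> [M1 [s [c [M1_gt0 cP pE]]]] [M2 [t [d [_ dP qE]]]].
exists (M1 + M2)%N, (fun j i => perm_sum (s j i) (t j i)), (row_mx c d).
split=> [||i]; first by rewrite addn_gt0 M1_gt0.
  move: cP dP; rewrite !inE => /forallP cP /forallP dP.
  apply/forallP => j; apply/forallP => m; rewrite -[m]splitK.
  case: (split m) => m' /=.
    have /forallP/(_ m') := cP j; congr (_ == _); apply: eq_bigr => i _.
    by rewrite perm_suml row_mxEl.
  have /forallP/(_ m') := dP j; congr (_ == _); apply: eq_bigr => i _.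
  by rewrite perm_sumr row_mxEr.
rewrite mnmDE pE qE big_split_ord /=.
by congr (_ + _)%N; apply: eq_bigr => m _; rewrite (row_mxEl, row_mxEr).
Qed.

(* The closed walk with vertices [v s] and edges [e s] lifts to a simple cycle
   of a cover with one sheet per step: sheet [s] of [v s] is joined to sheet
   [s] of [e s] and to sheet [s - 1] of [e (s - 1)]. *)
Lemma pseudocodeword_closed_walk k (e : 'I_k.+1 -> 'I_n) (v : 'I_k.+1 -> 'I_r)
    (p : 'X_{1..n}) :
  (forall s, bit_nbrs H (e s) = [set v s; v (ordS s)]) ->
  (forall s, v s != v (ordS s)) -> (forall s, e s != e (ordS s)) ->
  (forall i, p i = #|[set s | e s == i]|) -> unscaled_pseudocodeword H p.
Proof.
move=> endsE v_neq e_neq pE.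
(* [B j i s] says that step [s] enters check [j] through edge [i]. The permutation [f j i] swaps [s]
   with its predecessor for each such [s] and fixes all other sheets. *)
pose B j i s := (e (ord_pred s) == i) && (v s == j).
pose f j i s := if B j i s then ord_pred s else if B j i (ordS s) then ordS s else s.
(* Successive vertices differ, so these transpositions are disjoint and [f j i] is an involution. *)
have BS j i s : B j i s -> B j i (ordS s) = false.
  case/andP=> _ /eqP vs; apply/negP => /andP[_ /eqP vs'].
  by have := v_neq s; rewrite vs vs' eqxx.
have fK j i : involutive (f j i).
  move=> s; rewrite /f; case Bs: (B j i s).
    rewrite ord_predK Bs; case Bp: (B _ _ _) => //.
    by move: Bs; rewrite -[s]ord_predK (BS _ _ _ Bp).
  by case BSs: (B j i (ordS s)); rewrite ?BSs ?ordSK // Bs.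
have eE j i s : j \in bit_nbrs H i ->
    (e (f j i s) == i) = (v s == j) && ((e s == i) || (e (ord_pred s) == i)).
  move=> jX; rewrite /f; case Bs: (B j i s).
    by case/andP: Bs => -> ->; rewrite orbT.
  case BSs: (B j i (ordS s)).
    (* Here [s] is sent to its successor as a side effect of the swap; no stray one appears, since
       the next edge of the walk differs from [i]. *)
    case/andP: BSs; rewrite ordSK => /eqP ei /eqP vj.
    rewrite -ei eq_sym (negPf (e_neq s)) -vj.
    by rewrite (negPf (v_neq s)).
  case: eqVneq => [ei|_] /=; last by rewrite andbC -Bs.
  move: jX; rewrite -ei endsE => /set2P[->|vj]; first by rewrite eqxx.
  by move: BSs; rewrite /B ordSK ei vj !eqxx.
exists k.+1, (fun j i => perm (inv_inj (fK j i))).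
exists (\matrix_(i, s) (e s == i)%:R); split=> // [|i]; last first.
  rewrite pE -sum1_card big_mkcond; apply: eq_bigr => s _.
  by rewrite inE mxE; case: (_ == _).
rewrite inE; apply/forallP => j; apply/forallP => s.
have [vs|vs] := eqVneq (v s) j; last first.
  rewrite big1 // => i; rewrite inE => ij.
  by rewrite mxE permE eE ?inE // (negPf vs).
rewrite (eq_bigr (fun i => ((e s == i) || (e (ord_pred s) == i))%:R)); last first.
  by move=> i; rewrite inE => ij; rewrite mxE permE eE ?inE // vs eqxx.
(* At a sheet with [v s = j] the ones come from the edges by which the walk enters and leaves; they
   are distinct, so there are exactly two. *)
rewrite -natr_sum F2_natr_eq0 -big_mkcondr sum1_card.
rewrite (eq_card (B := [set e s; e (ord_pred s)])) => [|i].
  by rewrite cards2 -{1}[s]ord_predK eq_sym e_neq.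
rewrite unfold_in !inE ![i == _]eq_sym andb_idl // => /orP[] /eqP <-.
  have : j \in bit_nbrs H (e s) by rewrite endsE -vs set21.
  by rewrite inE.
have : j \in bit_nbrs H (e (ord_pred s)) by rewrite endsE ord_predK -vs set22.
by rewrite inE.
Qed.

(** The vertices of the closed walk are the origins of the directed edges in the witness [w]; each
    terminus is the origin of the next edge, cyclically. *)
Lemma pseudocodeword_cycle (G : seq 'I_n) : simple_graph (normal_graph H) ->
  is_cycle (normal_graph H) G -> nonbacktracking G ->
  unscaled_pseudocodeword H (mnm_of_seq G).
Proof.
move=> [X2 _] /andP[nzG /existsP[w /andP[/eqP wG cw]]] nbG.
case: G nzG w wG cw nbG => // i0 G _ w wG cw nbG.
pose k := size G; have szw : size w = k.+1 by rewrite size_tuple.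
pose d (s : 'I_k.+1) := tnth w s.
have dS s : (d s).2 = (d (ordS s)).1.
  rewrite /d !(tnth_nth (d ord0)) /=.
  have lts : (s < size w)%N by rewrite szw.
  by have /eqP := cycle_nth (d ord0) cw lts; rewrite szw.
have endsE (s : 'I_k.+1) :
    bit_nbrs H (nth i0 (i0 :: G) s) = [set (d s).1; (d (ordS s)).1].
  have := congr1 (fun l => nth set0 l s) wG.
  rewrite (nth_map (d s)) ?szw // (nth_map i0) // -dS /normal_graph => <-.
  by rewrite -tnth_nth.
apply: (pseudocodeword_closed_walk (e := fun s : 'I_k.+1 => nth i0 (i0 :: G) s) endsE).
- move=> s; have := X2 (nth i0 (i0 :: G) s).
  by rewrite /normal_graph endsE cards2; case: (_ != _).
- move=> s; have lts : (s < size (i0 :: G))%N by [].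
  exact: (cycle_nth (e := fun i j => i != j) i0 nbG lts).
move=> i; rewrite mnm_of_seqE -sum1_count (big_nth i0) big_mkord -sum1_card.
by apply: eq_bigl => s; rewrite inE.
Qed.

Lemma pseudocodeword_prime_sum_iff (p : 'X_{1..n}) :
  simple_graph (normal_graph H) ->
  unscaled_pseudocodeword H p <-> prime_sum (normal_graph H) p.
Proof.
move=> N_simple; split; first exact: pseudocodeword_prime_sum.
case=> s sP ->; rewrite big_seq; elim/big_ind: _ => [|a b|G /sP[cG bG tG _]].
- exact: pseudocodeword0.
- exact: pseudocodewordD.
apply: pseudocodeword_cycle => //; rewrite nonbacktrackingE ?bG //.
by case/andP: cG.
Qed.
End Pseudocodewords.

Theorem theorem5p4 (r n : nat) (H : 'M['F_2]_(r, n)) (C : {set 'rV['F_2]_n})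
  (n_gt0 : (0 < n)%N)
  (C_cycle_code : cycle_code H C)
  (N_simple : simple_graph (normal_graph H))
  (p : 'X_{1..n}) :
  fps_coef (edge_zeta (normal_graph H)) p != 0 <-> unscaled_pseudocodeword H p.
Proof.
by rewrite coef_edge_zeta_neq0 pseudocodeword_prime_sum_iff.
Qed.
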